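(* Let $V$ and $A$, $D$, the auxiliary spaces $V_j$ with operators $\Pi_j$, $A_j$, $D_j$ and coarse spaces $V_j^c\subset V_j$ ($j=1,\dots,J$) be as in the context, and suppose that: (1) there is a constant $C_{p,2}>0$ such that $\|\Pi_W\underset{\sim}{w}\|_D^2\le C_{p,2}\sum_{j=1}^J\|w_j\|_{D_j}^2$ for all $\underset{\sim}{w}=(w_1,\dots,w_J)\in\underset{\sim}{W}$; (2) there is a constant $C_{p,1}>0$ such that for each $w\in V$ there exists $\underset{\sim}{w}=(w_1,\dots,w_J)\in\underset{\sim}{W}$ with $w=\Pi_W\underset{\sim}{w}$ and $\sum_{j=1}^J\|w_j\|_{A_j}^2\le C_{p,1}\|w\|_A^2$; (3) $N(A_j)\subset V_j^c$ for all $j$. Let $V_c=\sum_{j=1}^J\Pi_jV_j^c$. Then for each $v\in V$ $$\min_{v_c\in V_c}\|v-v_c\|_D^2\le C_{p,1}\,C_{p,2}\,\mu_c^{-1}\,\|v\|_A^2 .$$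
   Context: Here $\underset{\sim}{W}$ and $\underset{\sim}{w}$ are just names (undertilde marks product-space objects). $V$ is a finite-dimensional real vector space with dual $V'$ and pairing $(\cdot,\cdot)$; $A:V\to V'$ is symmetric positive semi-definite and $D:V\to V'$ is symmetric positive definite. $V_1,\dots,V_J$ are finite-dimensional vector spaces (not necessarily subspaces of $V$) with linear operators $\Pi_j:V_j\to V$ such that $V=\sum_{j=1}^J\Pi_jV_j$. For each $j$, $A_j:V_j\to V_j'$ is symmetric positive semi-definite with kernel $N(A_j)$, $D_j:V_j\to V_j'$ is symmetric positive definite, and $V_j^c\subset V_j$ is a subspace. $\underset{\sim}{W}=V_1\times\cdots\times V_J$, and $\Pi_W:\underset{\sim}{W}\to V$, $\Pi_W\underset{\sim}{w}=\sum_{j=1}^J\Pi_jw_j$. For a symmetric semi-definite operator $M$, $\|v\|_M^2=(Mv,v)$. Define $$\mu_j(V_j^c)^{-1}=\max_{v_j\in V_j,\ \|v_j\|_{A_j}\neq0}\ \min_{v_j^c\in V_j^c}\frac{\|v_j-v_j^c\|_{D_j}^2}{\|v_j\|_{A_j}^2},\qquad \mu_c=\min_{1\le j\le J}\mu_j(V_j^c),$$ so that $\mu_c^{-1}=\max_j\mu_j(V_j^c)^{-1}$ (which is finite by (3)). *)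

(* Defs.v *)
From HB Require Import structures.
From mathcomp Require Import all_boot all_order all_algebra.
From mathcomp Require Import all_classical all_reals.

Set Implicit Arguments.
Unset Strict Implicit.
Unset Printing Implicit Defensive.

Import Order.TTheory GRing.Theory Num.Theory.

Local Open Scope classical_set_scope.
Local Open Scope ring_scope.

Section Operators.
Variables (R : realType) (V : vectType R).

Definition dual : vectType R := 'Hom(V, R^o).

Definition pairing (f : dual) (v : V) : R := f v.

Definition symmetric_op (M : 'Hom(V, dual)) : Prop :=
  forall u v : V, pairing (M u) v = pairing (M v) u.

Definition sym_psd (M : 'Hom(V, dual)) : Prop :=
  symmetric_op M /\ forall v : V, 0 <= pairing (M v) v.

Definition sym_pd (M : 'Hom(V, dual)) : Prop :=
  symmetric_op M /\ forall v : V, v != 0 -> 0 < pairing (M v) v.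

(* ||v||_M ^ 2 *)
Definition normsq (M : 'Hom(V, dual)) (v : V) : R := pairing (M v) v.

(* mu(Vc)^-1.  The extrema are attained in finite dimension (for the outer one,
   when N(A) is contained in Vc), so they are rendered by inf and sup.  If A = 0
   the outer set is empty and the value is sup set0 = 0. *)
Definition mu_inv (A D : 'Hom(V, dual)) (Vc : {vspace V}) : R :=
  sup [set inf [set normsq D (v - vc) / normsq A v | vc in [set` Vc]]
      | v in [set v : V | normsq A v != 0]].

(* mu_inv may vanish (e.g. when Vc is the whole space): mu takes values in
   ]0, +oo], using the convention 0^-1 = +oo, +oo^-1 = 0 of extended reals. *)
Definition mu (A D : 'Hom(V, dual)) (Vc : {vspace V}) : \bar R :=
  ((mu_inv A D Vc)%:E)^-1%E.

End Operators.

Section Families.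
Variables (R : realType) (J : nat) (V_ : 'I_J -> vectType R).

Definition mu_c (A_ D_ : forall j, 'Hom(V_ j, dual (V_ j)))
    (Vc_ : forall j, {vspace V_ j}) : \bar R :=
  \big[mine/+oo%E]_(j < J) mu (A_ j) (D_ j) (Vc_ j).

Variable V : vectType R.

(* The product space V_1 x ... x V_J is the type of dependent functions. *)
Definition Pi_W (Pi_ : forall j, 'Hom(V_ j, V)) (w : forall j, V_ j) : V :=
  \sum_(j < J) Pi_ j (w j).

End Families.

Definition is_min (R : realType) (S : set R) (m : R) : Prop :=
  S m /\ lbound S m.

(* Main.v *)
(* In finite dimension the D-distance from v to a subspace U is attained at the
   D-orthogonal projection of v on U.  Decompose v = Pi_W w stably in the A_j
   norms, project each w_j on V_j^c, and map the projections back to V_c: (1)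
   bounds the error by the D_j distances of the w_j to V_j^c, the definition of
   mu_j bounds these by the A_j norms, and (2) bounds the latter by the A norm
   of v.  The supremum defining mu_j^-1 is finite because A_j is definite modulo
   its kernel, which V_j^c contains. *)
Require Import Defs.
From HB Require Import structures.
From mathcomp Require Import all_boot all_order all_algebra.
From mathcomp Require Import all_classical all_reals.
From mathcomp Require Import ring lra.

Set Implicit Arguments.
Unset Strict Implicit.
Unset Printing Implicit Defensive.

Import Order.TTheory GRing.Theory Num.Theory.

Local Open Scope classical_set_scope.
Local Open Scope ring_scope.

Section SymmetricForms.
Variables (R : realType) (V : vectType R).
Implicit Types (M A D : 'Hom(V, dual V)) (U : {vspace V}).

Lemma pairingDl M u v w :
  pairing (M (u + v)) w = pairing (M u) w + pairing (M v) w.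
Proof. by rewrite /pairing linearD add_lfunE. Qed.

Lemma pairingDr M u v w :
  pairing (M w) (u + v) = pairing (M w) u + pairing (M w) v.
Proof. by rewrite /pairing linearD. Qed.

Lemma pairingZl M c u w : pairing (M (c *: u)) w = c * pairing (M u) w.
Proof. by rewrite /pairing linearZ scale_lfunE. Qed.

Lemma pairingZr M c u w : pairing (M w) (c *: u) = c * pairing (M w) u.
Proof. by rewrite /pairing linearZ. Qed.

Lemma pairing0l M w : pairing (M 0) w = 0.
Proof. by rewrite -(scale0r 0) pairingZl mul0r. Qed.

Lemma normsq0 M : normsq M 0 = 0.
Proof. exact: pairing0l. Qed.

Lemma sym_pd_psd M : sym_pd M -> sym_psd M.
Proof.
move=> [symM posM]; split=> // v.
have [->|/posM/ltW//] := eqVneq v 0.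
by rewrite pairing0l.
Qed.

Lemma normsqD M u v : symmetric_op M ->
  normsq M (u + v) = normsq M u + normsq M v + 2 * pairing (M u) v.
Proof.
move=> symM; rewrite /normsq pairingDl !pairingDr (symM v u).
ring.
Qed.

Lemma normsqZ M c u : normsq M (c *: u) = c ^+ 2 * normsq M u.
Proof. by rewrite /normsq pairingZl pairingZr mulrA expr2. Qed.

(** The gap between the two sides is [normsq M (u - v)]. *)
Lemma normsqD_le M u v : sym_psd M ->
  normsq M (u + v) <= 2 * normsq M u + 2 * normsq M v.
Proof.
move=> [symM posM].
have := posM (u + -1 *: v); rewrite -/(normsq _ _) !normsqD// normsqZ pairingZr.
lra.
Qed.

(* The quadratic polynomial [t |-> normsq M (y + t *: x)] would be affine and
   nonconstant, hence take negative values. *)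
Lemma normsq_eq0_pairing M x y : sym_psd M ->
  normsq M x = 0 -> pairing (M x) y = 0.
Proof.
move=> [symM posM] x0; apply/eqP; apply: contraT => b0.
set b := pairing _ _ in b0.
(* The parameter is chosen so that the polynomial takes the value -1. *)
have := posM (y + (- (normsq M y + 1) / (2 * b)) *: x).
rewrite -/(normsq _ _) normsqD// normsqZ x0 mulr0 addr0 pairingZr symM -/b.
have -> : 2 * (- (normsq M y + 1) / (2 * b) * b) = - (normsq M y + 1).
  by field.
lra.
Qed.

Lemma normsq_eq0_ker M x : sym_psd M -> normsq M x = 0 -> x \in lker M.
Proof.
move=> psdM x0; rewrite memv_ker; apply/eqP/lfunP => y.
by rewrite zero_lfunE; apply: (normsq_eq0_pairing y psdM x0).
Qed.

(** Gram-Schmidt along a basis of [U]. Semi-definiteness suffices, so both [A] and [D] are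
    covered. *)
Lemma orthogonal_projection M U v : sym_psd M ->
  exists2 u, u \in U & forall u', u' \in U -> pairing (M (v - u)) u' = 0.
Proof.
move=> psdM; rewrite -(span_basis (vbasisP U)).
elim: (tval _) v => [|x s IH] v.
  exists 0; first exact: mem0v.
  by move=> u'; rewrite span_nil memv0 => /eqP ->; rewrite /pairing linear0.
have [p ps pP] := IH x; have [q qs qP] := IH v.
have xpE c : q + c *: (x - p) = c *: x + (q - c *: p).
  by rewrite scalerBr addrCA.
(* If the denominator vanishes, [x - p] is [M]-orthogonal to every vector, and any coefficient would
   do. *)
pose c := pairing (M (v - q)) (x - p) / normsq M (x - p).
exists (q + c *: (x - p)).
  rewrite xpE span_cons; apply: memv_add; first by rewrite memvZ// memv_line.
  by rewrite memvB// memvZ.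
have symM := psdM.1.
have -> : v - (q + c *: (x - p)) = (v - q) + (- c) *: (x - p).
  by rewrite opprD addrA scaleNr.
move=> u'; rewrite span_cons => /memv_addP[_ /vlineP[k ->] [r rs ->]].
have -> : k *: x + r = k *: (x - p) + (k *: p + r).
  by rewrite scalerBr addrA subrK.
have krs : k *: p + r \in <<s>>%VS by rewrite memvD// memvZ.
rewrite pairingDr pairingZr !(pairingDl _ (v - q)) !pairingZl (qP _ krs) (pP _ krs).
rewrite mulr0 !addr0 -/(normsq _ _).
have [n0|n0] := eqVneq (normsq M (x - p)) 0.
  by rewrite n0 symM (normsq_eq0_pairing (v - q) psdM n0); ring.
by rewrite /c; field.
Qed.

(** Pythagoras: [v - u] is orthogonal to [u - w], which lies in [U]. *)
Lemma orthogonal_normsq_le M U v u w : sym_psd M -> u \in U -> w \in U ->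
  (forall u', u' \in U -> pairing (M (v - u)) u' = 0) ->
  normsq M (v - u) <= normsq M (v - w).
Proof.
move=> [symM posM] uU wU orth.
have -> : v - w = (v - u) + (u - w) by rewrite addrA subrK.
rewrite (normsqD (v - u))// orth ?memvB// mulr0 addr0 lerDl.
exact: posM.
Qed.

(* Gram-Schmidt with respect to A: each new direction x, orthogonal to the
   previous ones, either lies in the kernel or contributes the ratio
   [normsq D x / normsq A x] to the constant. *)
Lemma normsq_quotient_bound A D : sym_psd A -> sym_psd D ->
  exists K, forall v, exists2 n, n \in lker A &
    normsq D (v - n) <= K * normsq A v.
Proof.
move=> psdA psdD; have [symA posA] := psdA; have [symD posD] := psdD.
suff H (s : seq V) : exists2 K, 0 <= K & forall v, v \in <<s>>%VS ->
    exists2 n, n \in lker A & normsq D (v - n) <= K * normsq A v.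
  have [K _ KP] := H (vbasis fullv); exists K => v; apply: KP.
  by rewrite (span_basis (vbasisP fullv)) memvf.
elim: s => [|x s [K K0 IH]].
  exists 0 => // v; rewrite span_nil memv0 => /eqP ->.
  by exists 0; rewrite ?mem0v// subrr normsq0 mul0r.
have [p ps pP] := orthogonal_projection <<s>>%VS x psdA.
set y := x - p in pP.
have dec v : v \in <<x :: s>>%VS ->
    exists k, exists2 u, u \in <<s>>%VS & v = k *: y + u.
  rewrite span_cons => /memv_addP[_ /vlineP[k ->] [r rs ->]].
  exists k; exists (k *: p + r); first by rewrite memvD// memvZ.
  by rewrite /y scalerBr addrA subrK.
have Ay0 : 0 <= normsq A y by exact: posA.
have Dy0 : 0 <= normsq D y by exact: posD.
have normA k u : u \in <<s>>%VS ->
    normsq A (k *: y + u) = k ^+ 2 * normsq A y + normsq A u.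
  by move=> us; rewrite normsqD// normsqZ pairingZl pP// !mulr0 addr0.
have [n0|n0] := eqVneq (normsq A y) 0.
  exists K => // v /dec[k [u us ->]]; have [n nk nP] := IH u us.
  (* Here [y] is in the kernel of [A], so its multiple is absorbed into the kernel part at no
     cost. *)
  exists (k *: y + n).
    by rewrite memvD// memvZ//; apply: normsq_eq0_ker.
  by rewrite opprD addrACA subrr add0r normA// n0 mulr0 add0r.
(* The factors 2 come from [normsqD_le], applied to [k *: y] and [u - n]. *)
exists (2 * K + 2 * (normsq D y / normsq A y)).
  by rewrite addr_ge0// mulr_ge0// divr_ge0.
move=> v /dec[k [u us ->]]; have [n nk nP] := IH u us.
exists n => //; rewrite -addrA; apply: le_trans (normsqD_le _ _ psdD) _.
rewrite normsqZ normA//.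
set q := _ / normsq A y.
have -> : normsq D y = q * normsq A y by rewrite /q; field.
have q0 : 0 <= q by rewrite divr_ge0.
have Au0 : 0 <= normsq A u by exact: posA.
(* Apart from the factor 2, [t1] and [t2] are the cross terms of the expanded right-hand side; they
   are dropped. *)
have t1 : 0 <= K * (k ^+ 2 * normsq A y) by rewrite mulr_ge0// mulr_ge0// sqr_ge0.
have t2 : 0 <= q * normsq A u by rewrite mulr_ge0.
nra.
Qed.

Lemma mu_inv_ge0 A D U : sym_psd A -> sym_psd D -> 0 <= mu_inv A D U.
Proof.
move=> [_ posA] [_ posD]; rewrite /mu_inv; set S := [set _ | _ in _].
(* On an empty or unbounded set [sup] takes the default value 0. *)
have [supS|/sup_out ->//] := pselect (has_sup S).
have [x Sx] := supS.1.
apply: (@le_trans _ _ x); last exact: sup_upper_bound.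
case: Sx => v v0 <-.
apply: lb_le_inf.
  by exists (normsq D (v - 0) / normsq A v), 0 => //=; exact: mem0v.
by move=> _ [u _ <-]; apply: divr_ge0; [apply: posD|apply: posA].
Qed.

(** The projection of [v] realises the inner infimum, and the supremum dominates it once it is known
    to be finite. *)
Lemma mu_inv_approx A D U v : sym_psd A -> sym_psd D -> (lker A <= U)%VS ->
  exists2 u, u \in U & normsq D (v - u) <= mu_inv A D U * normsq A v.
Proof.
move=> psdA psdD kerU; have [_ posA] := psdA; have [_ posD] := psdD.
have [v0|v0] := eqVneq (normsq A v) 0.
  (* The supremum ignores such a [v], but the kernel inclusion puts [v] itself in [U]. *)
  exists v; first exact/(subvP kerU)/normsq_eq0_ker.
  by rewrite subrr normsq0 v0 mulr0.
have vgt0 : 0 < normsq A v by rewrite lt_def v0; apply: posA.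
have [u uU uP] := orthogonal_projection U v psdD.
exists u => //; rewrite -ler_pdivrMr//.
set I := [set normsq D (v - vc) / normsq A v | vc in [set` U]].
apply: (@le_trans _ _ (inf I)).
  apply: lb_le_inf; first by exists (normsq D (v - u) / normsq A v), u.
  move=> _ [w wU <-]; rewrite ler_pM2r ?invr_gt0//.
  exact: orthogonal_normsq_le uP.
apply: ub_le_sup; last by exists v.
(* Finiteness of the supremum: kernel elements belong to [U], so they compete in each infimum and
   bound it by [K]. *)
have [K KP] := normsq_quotient_bound psdA psdD.
exists K => _ [w /= w0 <-]; have [n nk nP] := KP w.
have wgt0 : 0 < normsq A w by rewrite lt_def w0; apply: posA.
apply: (@le_trans _ _ (normsq D (w - n) / normsq A w)).
  apply: ge_inf; last by exists n => //; apply: (subvP kerU).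
  exists 0 => _ [z _ <-]; apply: divr_ge0; [exact: posD|exact: ltW].
by rewrite ler_pdivrMr.
Qed.

End SymmetricForms.

(** Inversion reverses the order on nonnegative numbers, including 0, whose inverse is [+oo]. *)
Lemma inve_max (R : realType) (x y : R) : 0 <= x -> 0 <= y ->
  ((Num.max x y)%:E^-1 = mine x%:E^-1 y%:E^-1)%E.
Proof.
wlog xy : x y / x <= y.
  move=> H x0 y0; case/orP: (le_total x y) => [xy|yx]; first exact: H.
  by rewrite maxC minC H.
move=> x0 y0; rewrite (max_idPr xy); apply/esym/min_idPr.
rewrite !inver; case: (eqVneq x 0) => [_|xn0]; first by rewrite leey.
have xgt0 : 0 < x by rewrite lt_def xn0.
have ygt0 : 0 < y by exact: lt_le_trans xy.
by rewrite gt_eqF// lee_fin lef_pV2.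
Qed.

Lemma mu_cV (R : realType) (J : nat) (V_ : 'I_J -> vectType R)
    (A_ D_ : forall j, 'Hom(V_ j, dual (V_ j))) (Vc_ : forall j, {vspace V_ j}) :
  (forall j, sym_psd (A_ j)) -> (forall j, sym_psd (D_ j)) ->
  ((mu_c A_ D_ Vc_)^-1 =
    (\big[Num.max/0%R]_(j < J) mu_inv (A_ j) (D_ j) (Vc_ j))%:E)%E.
Proof.
move=> hA hD; rewrite -[RHS]inveK; congr inve.
set m := (X in X%:E).
(* Nonnegativity is carried through the induction because [inve_max] requires it; the initial values
   match since the inverse of 0 is [+oo]. *)
suff [] : 0 <= m /\ mu_c A_ D_ Vc_ = (m%:E^-1)%E by [].
rewrite /m /mu_c.
elim/big_rec2 : _ => [|j y x _ [x0 ->]]; first by rewrite inve0.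
have mu0 := mu_inv_ge0 (Vc_ j) (hA j) (hD j).
by rewrite le_max mu0 inve_max.
Qed.

Theorem theorem6p2 (R : realType) (V : vectType R)
  (A D : 'Hom(V, dual V)) (hA : sym_psd A) (hD : sym_pd D)
  (J : nat) (hJ : (0 < J)%N)
  (V_ : 'I_J -> vectType R)
  (Pi_ : forall j : 'I_J, 'Hom(V_ j, V))
  (hPi : (\sum_(j < J) limg (Pi_ j))%VS = fullv)
  (A_ D_ : forall j : 'I_J, 'Hom(V_ j, dual (V_ j)))
  (hA_ : forall j, sym_psd (A_ j)) (hD_ : forall j, sym_pd (D_ j))
  (Vc_ : forall j : 'I_J, {vspace V_ j})
  (Cp1 Cp2 : R) (hCp2 : 0 < Cp2)
  (h1 : forall w : (forall j, V_ j),
    normsq D (Pi_W Pi_ w) <= Cp2 * \sum_(j < J) normsq (D_ j) (w j))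
  (hCp1 : 0 < Cp1)
  (h2 : forall v : V, exists w : (forall j, V_ j),
    v = Pi_W Pi_ w /\
    \sum_(j < J) normsq (A_ j) (w j) <= Cp1 * normsq A v)
  (h3 : forall j, (lker (A_ j) <= Vc_ j)%VS) :
  let Vc := (\sum_(j < J) (Pi_ j @: Vc_ j))%VS in
  forall v : V, exists m : R,
    is_min [set normsq D (v - vc) | vc in [set` Vc]] m /\
    (m%:E <= Cp1%:E * Cp2%:E * (mu_c A_ D_ Vc_)^-1 * (normsq A v)%:E)%E.
Proof.
move=> Vc v; have psdD := sym_pd_psd hD.
have psdD_ j := sym_pd_psd (hD_ j).
have [u uVc uP] := orthogonal_projection Vc v psdD.
exists (normsq D (v - u)); split.
  split; first by exists u.
  by move=> _ [z zVc <-]; apply: orthogonal_normsq_le uP.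
rewrite mu_cV// -!EFinM lee_fin.
set mu := \big[_/_]_(_ < _) _.
have [w [vw wA]] := h2 v.
have app j := cid2 (mu_inv_approx (w j) (hA_ j) (psdD_ j) (h3 j)).
pose wc j := s2val (app j).
have wcV j : wc j \in Vc_ j := s2valP (app j).
have wcP j : normsq (D_ j) (w j - wc j) <= _ := s2valP' (app j).
(* As [u] is a minimiser, the image of the local approximations is an admissible competitor. *)
apply: (@le_trans _ _ (normsq D (v - Pi_W Pi_ wc))).
  apply: (orthogonal_normsq_le psdD uVc _ uP).
  by apply: memv_sumr => j _; apply: memv_img.
have -> : v - Pi_W Pi_ wc = Pi_W Pi_ (fun j => w j - wc j).
  by rewrite vw /Pi_W -sumrB; apply: eq_bigr => j _; rewrite linearB.
apply: le_trans (h1 _) _.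
have mu0 : 0 <= mu by apply: bigmax_ge_id.
(* Regrouped so that [Cp2] cancels against the bound from [h1] and [wA] supplies the inner
   factor. *)
have -> : Cp1 * Cp2 * mu * normsq A v = Cp2 * (mu * (Cp1 * normsq A v)) by ring.
rewrite ler_pM2l//; apply: le_trans (ler_wpM2l mu0 wA).
rewrite mulr_sumr; apply: ler_sum => j _; apply: le_trans (wcP j) _.
apply: ler_wpM2r; first exact: (hA_ j).2.
exact: le_bigmax.
Qed.
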